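(* Let $p\ge0$ be an integer, $\omega\in\mathbb{C}$, $h_j>0$, with $g(\omega h_j)\neq0$. Then for $\xi\in[-1,1]$ $$\frac{f(\omega h_j,\xi)}{g(\omega h_j)}=e^{\frac{\omega h_j}{2}(\xi+1)}-\frac{(-1)^{p+1}(\omega h_j)^{p+1}}{2g(\omega h_j)}\left[R^-_{p+1}(\xi)+\sum_{k=1}^\infty\left(\frac{\omega h_j}{2}\right)^kR^{-,(-k)}_{p+1}(\xi)\right],$$ and, in particular, $$\frac{f(\omega h_j,1)}{g(\omega h_j)}=e^{\omega h_j}+\mathcal{O}((\omega h_j)^{2p+2})\quad\text{as }\omega h_j\to0,$$ i.e. $\frac{f(z,1)}{g(z)}$ is the $\frac{p}{p+1}$ Padé approximant of $e^z$.
   Context: $P_k$ is the Legendre polynomial of degree $k$ on $[-1,1]$ with $P_k(1)=1$, $R^-_{p+1}=P_{p+1}-P_p$ is the right Radau polynomial, and its repeated integrals are $R^{-,(0)}_{p+1}=R^-_{p+1}$, $R^{-,(-(k+1))}_{p+1}(\xi)=\int_{-1}^{\xi}R^{-,(-k)}_{p+1}(s)\,ds$. The polynomials $f$ and $g$ are $$f(z,\xi)=\frac{(-1)^{p+1}}{2}\sum_{k=1}^{p+1}2^k z^{p+1-k}\frac{d^k}{d\xi^k}R^-_{p+1}(\xi),\qquad g(z)=z^{p+1}+\frac{(-1)^{p+1}}{2}\sum_{k=1}^{p+1}2^k z^{p+1-k}\frac{d^kR^-_{p+1}}{d\xi^k}(-1).$$ Given integers $m,n$ and a sufficiently smooth function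 $F$, the $\frac mn$ Padé approximant of $F$ is a rational function $P(z)/Q(z)$ with $P,Q$ polynomials of degree $m$ and $n$ respectively, satisfying $\frac{P(z)}{Q(z)}=F(z)+\mathcal{O}(z^{m+n+1})$; it is unique up to a common constant multiple of numerator and denominator (conventionally normalized by $Q(0)=1$). *)

(* Defs.v *)
From HB Require Import structures.
From mathcomp Require Import all_boot all_order all_algebra.
From mathcomp Require Import complex.
From mathcomp Require Import all_classical all_reals all_analysis.

Set Implicit Arguments.
Unset Strict Implicit.
Unset Printing Implicit Defensive.

Import Order.TTheory GRing.Theory Num.Theory.
Import numFieldNormedType.Exports.

Local Open Scope classical_set_scope.
Local Open Scope ring_scope.
Local Open Scope complex_scope.

(* The topology of the complex modulus; its canonical instances are stated for
   variables of type numFieldType, hence are not found on R[i] otherwise. *)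
HB.instance Definition _ (R : realType) := NormedModule.copy R[i] R[i]^o.

(* Rodrigues' formula, with the normalization P_k(1) = 1. *)
Definition legendre (R : realType) (k : nat) : {poly R} :=
  (2 ^+ k * k`!%:R)^-1 *: (('X ^+ 2 - 1) ^+ k)^`(k).

(* The right Radau polynomial of degree n; meant for n > 0 only. *)
Definition radau (R : realType) (n : nat) : {poly R} :=
  legendre R n - legendre R n.-1.

(* [radau_int n k] is the k-fold repeated integral, of order (-k); the integral
   is the oriented one for -1 <= xi only. *)
Fixpoint radau_int (R : realType) (n k : nat) (xi : R) : R :=
  if k is k'.+1 then
    \int[lebesgue_measure]_(s in `[-1, xi]%classic) radau_int n k' s
  else (radau R n).[xi].

(* f and g are polynomials in z, for xi fixed. *)
Definition f_poly (R : realType) (p : nat) (xi : R) : {poly R[i]} :=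
  ((-1) ^+ p.+1 / 2) *:
  \sum_(1 <= k < p.+2)
     (2 ^+ k * ((radau R p.+1)^`(k)).[xi]%:C) *: 'X^(p.+1 - k).

Definition g_poly (R : realType) (p : nat) : {poly R[i]} :=
  'X^(p.+1) + ((-1) ^+ p.+1 / 2) *:
  \sum_(1 <= k < p.+2)
     (2 ^+ k * ((radau R p.+1)^`(k)).[-1]%:C) *: 'X^(p.+1 - k).

(* Same definition as expR, in R[i]. *)
Definition cexp (R : realType) (z : R[i]) : R[i] :=
  limn (series (fun n => z ^+ n / n`!%:R : R[i])).

(* P / Q is the m/n Pade approximant of F. Degrees are exact. Q(0) = 1 is
   only a normalization of (P, Q) up to a common constant. *)
Definition is_pade (K : numFieldType) (m n : nat) (F : K -> K)
    (P Q : {poly K}) : Prop :=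
  [/\ size P = m.+1, size Q = n.+1, Q.[0] != 0 &
   (fun z : K => P.[z] / Q.[z] - F z) =O_ (nbhs (0 : K))
   (fun z : K => z ^+ (m + n).+1)].

(* Main.v *)
Require Import Defs.
From HB Require Import structures.
From mathcomp Require Import all_boot all_order all_algebra.
From mathcomp Require Import complex.
From mathcomp Require Import all_classical all_reals all_analysis.
From mathcomp Require Import ring lra zify.
Import Order.TTheory GRing.Theory Num.Theory.
Import numFieldNormedType.Exports.
Local Open Scope classical_set_scope.
Local Open Scope ring_scope.
Local Open Scope complex_scope.

(** Put c = (-1)^(p+1)/2, let r_j be the j-th derivative of the Radau polynomial
at -1, and let t = xi + 1.  As c * r_0 = 1, the term z^(p+1) of g is the missing
term k = 0 of its sum, so that

  g(z) = c * sum_(j <= p+1) r_j 2^j z^(p+1-j).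

By Taylor's formula at -1, the derivative of order k of the Radau polynomial is
sum_j r_j t^(j-k)/(j-k)! over j >= k, and repeated integration from -1 continues
this formula to negative k.  Hence f and the series of repeated integrals are
the positive and the nonpositive part of one sum over k, in which the factor of
r_j is

  sum_(k <= j) 2^k z^(p+1-k) t^(j-k)/(j-k)! = 2^j z^(p+1-j) e^(z t/2).

Summing over j gives f + c z^(p+1) [R + sum_k (z/2)^k R^(-k)] = g e^(z t/2), the
first claim.  The identity is proved for partial sums
([exp_sum_split], [f_poly_radau_int_sum]), where it is purely algebraic; the
convergence of the series of repeated integrals then follows from that of the
exponential series ([cvg_tail_sum], [f_poly_expansion]).

For the order of approximation take xi = 1.  Rodrigues' formula gives primitives
of the Radau polynomial: differentiating (x^2-1)^n fewer than n times leaves a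
polynomial vanishing at both -1 and 1.  So the first p repeated integrals vanish
at 1 ([radau_int_right]), which is the orthogonality of the Legendre polynomials
in another form, and so does the Radau polynomial itself, as P_k(1) = 1.  The
finite identity with p + 1 terms then reads

  f(z,1) = c * sum_(j <= p+1) r_j 2^j z^(p+1-j) E_(j+p+1)(z),

where E_m is the exponential series cut before degree m.  Since
E_m(z) - e^z = O(z^m), each term of f - g e^z is
O(z^(p+1-j) z^(j+p+1)) = O(z^(2p+2)) ([f_poly_pade_error]).

The degrees come from R'(1) = p+1 and from the term z^(p+1) of g, and g(0) is
nonzero because R has degree exactly p+1. *)

(** * Polynomials *)

Lemma derivn_comp_XaddC (A : comNzRingType) (P : {poly A}) (a : A) k :
  (P \Po ('X + a%:P))^`(k) = P^`(k) \Po ('X + a%:P).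
Proof.
elim: k => [|k IH]; first by rewrite !derivn0.
by rewrite !derivnS IH deriv_comp derivD derivX derivC addr0 mulr1.
Qed.

Lemma horner_derivn_coef (A : comNzRingType) (P : {poly A}) (a : A) k :
  P^`(k).[a] = (P \Po ('X + a%:P))`_k *+ k`!.
Proof.
have -> : P^`(k).[a] = ((P \Po ('X + a%:P))^`(k)).[0].
  by rewrite derivn_comp_XaddC horner_comp !hornerE.
by rewrite horner_coef0 coef_derivn addn0 ffactnn.
Qed.

(** Centred at an endpoint a, x^2 - 1 is X (X + 2 a), so the derivatives of
its n-th power at a are read off the coefficients of X^n (X + 2 a)^n. *)
Lemma horner_derivn_rodrigues (A : comNzRingType) (a : A) n k :
  a ^+ 2 = 1 ->
  ((('X ^+ 2 - 1) ^+ n)^`(k)).[a] =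
  if (k < n)%N then 0 else (('X + (2 * a)%:P) ^+ n)`_(k - n) *+ k`!.
Proof.
move=> a2; rewrite horner_derivn_coef.
have -> : (('X ^+ 2 - 1) ^+ n) \Po ('X + a%:P) =
          'X^n * ('X + (2 * a)%:P) ^+ n :> {poly A}.
  rewrite rmorphXn /= -exprMn rmorphB rmorphXn /= comp_polyX.
  have -> : 1 \Po ('X + a%:P) = (a ^+ 2)%:P by rewrite a2 comp_polyC.
  by congr (_ ^+ n); rewrite rmorphXn rmorphM /= rmorphMn /=; ring.
by rewrite coefXnM; case: ltnP => // _; rewrite mul0rn.
Qed.

Lemma coef1_XaddC_exp (A : comNzRingType) (c : A) n :
  (('X + c%:P) ^+ n)`_1 = c ^+ n.-1 *+ n.
Proof.
rewrite -[LHS](@coef_deriv _ _ 0) -horner_coef0 deriv_exp derivD derivX derivC.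
by rewrite addr0 mul1r hornerMn horner_exp !hornerE.
Qed.

Lemma sum_rev_powersE (A : nzRingType) (a : nat -> A) n :
  \sum_(1 <= k < n.+1) a k *: 'X^(n - k) = \poly_(i < n) a (n - i)%N.
Proof.
rewrite poly_def big_add1 big_nat_rev /= big_mkord; apply: eq_bigr => i _.
have i_lt : (i < n)%N by [].
have -> : (0 + n - i.+1).+1 = (n - i)%N by lia.
by rewrite (subKn (ltnW i_lt)).
Qed.

Lemma continuous_horner_numField (K : numFieldType) (P : {poly K}) :
  continuous (fun x : K => P.[x]).
Proof.
elim/poly_ind: P => [|P a IH].
  have -> : (fun y : K => (0 : {poly K}).[y]) = cst 0.
    by apply/funext => y; rewrite horner0.
  exact: cst_continuous.
have -> : (fun y => (P * 'X + a%:P).[y]) = (fun y => P.[y] * y + a).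
  by apply/funext => y; rewrite !hornerE.
move=> x; apply: (@continuousD _ _ _ (fun y => P.[y] * y) (cst a)).
  by apply: (@continuousM _ _ (fun y => P.[y]) id); [exact: IH|exact: cvg_id].
exact: cst_continuous.
Qed.

(** * Splitting the exponential series *)

(** The coefficient of r_j in the main identity: the two sums on the left run
over the derivatives and the repeated integrals of t^j / j!, and yield the terms
m < j and m >= j of one truncated exponential series. *)
Lemma exp_sum_split (K : numFieldType) (z t : K) (N j n : nat) : (j <= N)%N ->
  \sum_(1 <= k < N.+1) 2 ^+ k * z ^+ (N - k) *
     (if (k <= j)%N then t ^+ (j - k) / (j - k)`!%:R else 0)
  + z ^+ N * \sum_(0 <= k < n) (z / 2) ^+ k * (t ^+ (j + k) / (j + k)`!%:R)
  = 2 ^+ j * z ^+ (N - j) * \sum_(0 <= m < j + n) (z / 2 * t) ^+ m / m`!%:R.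
Proof.
move=> jN; rewrite [in RHS](big_cat_nat (n := j)) ?leq_addr //= mulrDr.
congr (_ + _).
  rewrite (big_cat_nat (n := j.+1)) //= [X in _ + X]big_nat.
  rewrite [X in _ + X]big1 => [|k].
    rewrite addr0 big_add1 big_nat_rev /= mulr_sumr.
    apply: eq_big_nat => m /andP[_ mj].
    have -> : (0 + j - m.+1).+1 = (j - m)%N by lia.
    rewrite leq_subr subKn 1?ltnW //.
    have -> : (N - (j - m) = (N - j) + m)%N by lia.
    have -> : 2 ^+ j = 2 ^+ (j - m) * 2 ^+ m :> K
      by rewrite -exprD subnK 1?ltnW.
    have ? : (2 ^+ m : K) != 0 by rewrite expf_neq0.
    have ? : (m`!%:R : K) != 0 by rewrite pnatr_eq0 -lt0n fact_gt0.
    by rewrite exprD !exprMn exprVn; field; apply/andP.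
  by case/andP=> jk _; rewrite leqNgt jk mulr0.
have -> (F : nat -> K) :
    \sum_(j <= m < j + n) F m = \sum_(0 <= k < n) F (k + j)%N.
  by rewrite -{1}[j]add0n big_addn addKn.
rewrite !mulr_sumr; apply: eq_bigr => k _.
have -> : z ^+ N = z ^+ (N - j) * z ^+ j by rewrite -exprD subnK.
rewrite [(j + k)%N]addnC !exprMn ![_ ^+ (k + j)]exprD !exprVn.
have ? : (2 ^+ k : K) != 0 by rewrite expf_neq0.
have ? : (2 ^+ j : K) != 0 by rewrite expf_neq0.
have ? : ((k + j)`!%:R : K) != 0 by rewrite pnatr_eq0 -lt0n fact_gt0.
by field; do ?[apply/andP; split].
Qed.

(** * Legendre and Radau polynomials *)

Section Legendre.
Variable R : realType.
Implicit Types (a x xi : R) (n k p : nat).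

(** The k-fold repeated integral from -1 of the Legendre polynomial of degree
n, for k <= n only. *)
Definition legendre_int n k : {poly R} :=
  (2 ^+ n * n`!%:R)^-1 *: (('X ^+ 2 - 1) ^+ n)^`(n - k).

Lemma legendre_int0 n : legendre_int n 0 = legendre R n.
Proof. by rewrite /legendre_int subn0. Qed.

Lemma deriv_legendre_int n k :
  (k < n)%N -> (legendre_int n k.+1)^`() = legendre_int n k.
Proof. by move=> kn; rewrite /legendre_int derivZ -derivnS subnSK. Qed.

Lemma legendre_int_end n k a :
  a ^+ 2 = 1 -> (0 < k <= n)%N -> (legendre_int n k).[a] = 0.
Proof.
move=> a2 /andP[k0 kn]; rewrite hornerZ horner_derivn_rodrigues //.
by rewrite ltn_subrL k0 (leq_trans k0 kn) mulr0.
Qed.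

Lemma rodrigues_const_neq0 n : (2 ^+ n * n`!%:R : R) != 0.
Proof. by rewrite mulf_neq0 ?expf_neq0 ?pnatr_eq0 // -lt0n fact_gt0. Qed.

Lemma legendre_end n a : a ^+ 2 = 1 -> (legendre R n).[a] = a ^+ n.
Proof.
move=> a2; rewrite hornerZ horner_derivn_rodrigues // ltnn subnn.
rewrite -horner_coef0 !hornerE exprMn -mulr_natr.
have := rodrigues_const_neq0 n; rewrite mulf_eq0 negb_or => /andP[? ?].
by field; apply/andP; split.
Qed.

Lemma deriv_legendre_end n a :
  a ^+ 2 = 1 -> (legendre R n)^`().[a] = a ^+ n.-1 * (n * n.+1)%:R / 2.
Proof.
move=> a2; rewrite derivZ hornerZ -derivnS horner_derivn_rodrigues //.
rewrite ltnNge leqnSn /= subSnn coef1_XaddC_exp.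
case: n => [|n]; first by rewrite !mulr0n mul0rn !mulr0 mul0r.
rewrite exprMn !factS -[_ *+ n.+1 *+ _]mulr_natr -[_ *+ n.+1]mulr_natr.
rewrite !natrM [_ ^+ n.+1]exprS.
have n0 : (n.+1%:R : R) != 0 by rewrite pnatr_eq0.
have := rodrigues_const_neq0 n; rewrite mulf_eq0 negb_or => /andP[].
move: (n`!%:R : R) (2 ^+ n : R) (a ^+ n) (n.+2%:R : R) => u v w s u0 v0.
move: (n.+1%:R : R) n0 => t t0.
by field; rewrite t0 u0 v0.
Qed.

Lemma size_legendre n : size (legendre R n) = n.+1.
Proof.
rewrite size_scale ?invr_eq0 ?rodrigues_const_neq0 //.
set Q := (_ ^+ n : {poly R}).
have Q0 : (0 < size Q)%N.
  by rewrite size_poly_gt0 expf_neq0 // -size_poly_gt0 size_Xn_sub_1.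
rewrite cauchyreals.size_derivn -(prednK Q0) size_exp size_Xn_sub_1 //.
by rewrite mul2n -addnn -addSn addnK.
Qed.

Lemma radau_left p : (radau R p.+1).[-1] = 2 * (-1) ^+ p.+1.
Proof.
rewrite hornerD hornerN !legendre_end ?sqrrN ?expr1n //.
by rewrite exprS /=; ring.
Qed.

Lemma radau_right p : (radau R p.+1).[1] = 0.
Proof. by rewrite hornerD hornerN !legendre_end ?expr1n ?subrr. Qed.

Lemma deriv_radau_right p : (radau R p.+1)^`().[1] = p.+1%:R.
Proof.
rewrite derivB hornerD hornerN !deriv_legendre_end ?expr1n //= !mul1r.
by rewrite !natrM -!natr1; field.
Qed.

Lemma size_radau p : size (radau R p.+1) = p.+2.
Proof. by rewrite size_polyDl ?size_polyN !size_legendre. Qed.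

Lemma derivn_radau_neq0 p xi : (radau R p.+1)^`(p.+1).[xi] != 0.
Proof.
have /eqP/size_poly1P[c c0 ->] : size (radau R p.+1)^`(p.+1) = 1.
  by rewrite cauchyreals.size_derivn size_radau subSnn.
by rewrite hornerC.
Qed.

(** Taylor's formula for all derivatives at once, summed over the same range
of j for every k: the sums over j and k in f can then be exchanged. *)
Lemma horner_derivn_taylor N (P : {poly R}) a x k : (size P <= N.+1)%N ->
  P^`(k).[x] = \sum_(j < N.+1) P^`(j).[a] *
    (if (k <= j)%N then (x - a) ^+ (j - k) / (j - k)`!%:R else 0).
Proof.
move=> sP; have sPk : (size P^`(k) <= N.+1)%N.
  by rewrite cauchyreals.size_derivn (leq_trans (leq_subr _ _)).
rewrite -{1}(subrKC a x) (nderiv_taylor_wide (n := N.+1)) //; last exact: mulrC.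
pose F j := P^`(j).[a] *
  (if (k <= j)%N then (x - a) ^+ (j - k) / (j - k)`!%:R else 0).
rewrite -(big_mkord xpredT F) /=.
have FkE i : P^`(k)^`N(i).[a] * (x - a) ^+ i = F (i + k)%N.
  rewrite /F leq_addl addnK; have i0 : (i`!%:R : R) != 0.
    by rewrite pnatr_eq0 -lt0n fact_gt0.
  have -> : P^`(i + k).[a] = P^`(k)^`N(i).[a] * i`!%:R.
    by rewrite mulr_natr -hornerMn -nderivn_def /derivn iterD.
  by field.
under eq_bigr do rewrite FkE.
have F_big j : (N < j)%N -> F j = 0.
  by move=> Nj; rewrite /F derivn_poly0 ?(leq_trans sP) // horner0 mul0r.
rewrite -(big_mkord xpredT (fun i => F (i + k)%N)) /=.
have F_small j : (j < k)%N -> F j = 0 by move=> jk; rewrite /F leqNgt jk mulr0.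
transitivity (\sum_(0 <= j < N.+1 + k) F j).
  have F_low : \sum_(0 <= j < k) F j = 0.
    by rewrite big_nat big1 // => j /andP[_ /F_small].
  rewrite [RHS](big_cat_nat (n := k)) ?leq_addl //= F_low add0r.
  by rewrite -{2}[k]add0n big_addn addnK.
have F_high : \sum_(N.+1 <= j < N.+1 + k) F j = 0.
  by rewrite big_nat big1 // => j /andP[/F_big].
by rewrite (big_cat_nat (n := N.+1)) ?leq_addr //= F_high addr0.
Qed.

(** * Repeated integrals *)

Lemma Rintegral_poly (P : {poly R}) a x : a <= x ->
  \int[lebesgue_measure]_(s in `[a, x]) P^`().[s] = P.[x] - P.[a].
Proof.
rewrite le_eqVlt => /predU1P[<-|ax].
  by rewrite set_itv1 Rintegral_set1 subrr.
rewrite /Rintegral (continuous_FTC2 (F := horner P)) //.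
- by apply: continuous_subspaceT; exact: continuous_horner.
- split.
  + by move=> y _; exact: derivable_horner.
  + by apply: cvg_at_right_filter; exact: continuous_horner.
  + by apply: cvg_at_left_filter; exact: continuous_horner.
- by move=> y _; rewrite derivE.
Qed.

(** This is the fundamental theorem of calculus, iterated.  The bound m is there
because Rodrigues' formula provides primitives up to a finite order only,
whereas the Taylor expansion at -1 does so for every order. *)
Lemma radau_int_primitives n m (Q : nat -> {poly R}) :
  horner (Q 0) =1 horner (radau R n) ->
  (forall k, (k < m)%N -> (Q k.+1)^`() = Q k) ->
  (forall k, (k < m)%N -> (Q k.+1).[-1] = 0) ->
  forall k xi, (k <= m)%N -> -1 <= xi -> radau_int n k xi = (Q k).[xi].
Proof.
move=> Q0 Qd Q1; elim=> [|k IH] xi km xi1 /=; first by rewrite Q0.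
transitivity (\int[lebesgue_measure]_(s in `[-1, xi]) (Q k.+1)^`().[s]).
  apply: eq_Rintegral => s; rewrite inE /= in_itv /= => /andP[s1 _].
  by rewrite Qd // IH // ltnW.
by rewrite Rintegral_poly // Q1 // subr0.
Qed.

Lemma radau_int_taylor p k xi : -1 <= xi ->
  radau_int p.+1 k xi = \sum_(j < p.+2)
    (radau R p.+1)^`(j).[-1] * ((xi + 1) ^+ (j + k) / (j + k)`!%:R).
Proof.
move=> xi1; pose r j := (radau R p.+1)^`(j).[-1].
pose Q m : {poly R} :=
  \sum_(j < p.+2) (r j / (j + m)`!%:R) *: ('X + 1%:P) ^+ (j + m).
have QE m x : (Q m).[x] =
    \sum_(j < p.+2) r j * ((x + 1) ^+ (j + m) / (j + m)`!%:R).
  rewrite horner_sum; apply: eq_bigr => j _.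
  rewrite hornerZ horner_exp !hornerE; exact: mulrAC.
rewrite (@radau_int_primitives p.+1 k Q) //.
- move=> x; rewrite QE -[RHS]/(radau R p.+1)^`(0).[x].
  rewrite (@horner_derivn_taylor p.+1 _ (-1)) ?size_radau // opprK.
  by apply: eq_bigr => j _; rewrite subn0 addn0.
- move=> m _; rewrite /Q raddf_sum /=; apply: eq_bigr => j _.
  rewrite derivZ deriv_exp derivD derivX derivC addr0 mul1r addnS /=.
  rewrite -[_ *+ (j + m).+1]scaler_nat scalerA factS natrM.
  have ? : ((j + m)`!%:R : R) != 0 by rewrite pnatr_eq0 -lt0n fact_gt0.
  have ? : ((j + m).+1%:R : R) != 0 by rewrite pnatr_eq0.
  by congr (_ *: _); field; apply/andP.
- move=> m _; rewrite QE big1 // => j _.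
  by rewrite addNr addnS expr0n /= mul0r mulr0.
Qed.

(** The primitives given by Rodrigues' formula have enough factors x - 1 left
to vanish at 1 as well. *)
Lemma radau_int_right p k : (0 < k <= p)%N -> radau_int p.+1 k (1 : R) = 0.
Proof.
move=> /andP[k0 kp].
pose Q m : {poly R} := legendre_int p.+1 m - legendre_int p m.
have end0 a m : a ^+ 2 = 1 -> (0 < m <= p)%N -> (Q m).[a] = 0.
  move=> a2 mp; rewrite hornerD hornerN !legendre_int_end ?subrr //.
  by case/andP: mp => -> /leqW.
rewrite (@radau_int_primitives p.+1 p Q) ?end0 ?expr1n ?k0 ?ge0_cp //.
- by move=> x; rewrite /Q !legendre_int0.
- by move=> m mp; rewrite derivB !deriv_legendre_int // ltnW.
- by move=> m mp; rewrite end0 ?sqrrN ?expr1n.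
Qed.

End Legendre.

(** * The complex exponential series *)

Section ComplexExponential.
Variable R : realType.
Implicit Types (z l : R[i]) (u : nat -> R[i]) (n m : nat).

Lemma normc_real (x : R) : `|x%:C| = `|x|%:C.
Proof. by rewrite normc_def /= expr0n addr0 sqrtr_sqr. Qed.

Lemma normc_Re_norm z : (complex.Re `|z|)%:C = `|z|.
Proof. exact/RRe_real/normr_real. Qed.

(** Reduces the convergence of a complex series to the completeness of the
reals. *)
Lemma cvg_complex u (a b : R) :
  complex.Re (u n) @[n --> \oo] --> a -> complex.Im (u n) @[n --> \oo] --> b ->
  u n @[n --> \oo] --> (a +i* b : R[i]).
Proof.
move=> ua ub; apply/cvgrPdist_le => e e0.
have [r re] : exists r : R, r%:C = e.
  by have /complex_realP[r ->] := gtr0_real e0; exists r.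
have r0 : 0 < r by rewrite -ltcR re.
have r2 : 0 < r / 2 by rewrite divr_gt0.
move/cvgrPdist_le : ua => /(_ _ r2) ua; move/cvgrPdist_le : ub => /(_ _ r2) ub.
near=> n.
have -> : (a +i* b : R[i]) - u n =
    (a - complex.Re (u n))%:C + 'i%C * (b - complex.Im (u n))%:C.
  by rewrite [LHS]complexE; case: (u n).
rewrite (le_trans (ler_normD _ _)) // normrM !normc_real.
have -> : `|'i%C : R[i]| = 1 by rewrite normc_def /= expr0n expr1n add0r sqrtr1.
rewrite mul1r -rmorphD /= -re lecR [r]splitr lerD //; near: n.
- exact: ua.
- exact: ub.
Unshelve. all: by end_near. Qed.

Definition exp_sum z : nat -> R[i] := series (fun n => z ^+ n / n`!%:R).

Lemma cvg_exp_sum z : exp_sum z n @[n --> \oo] --> cexp z.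
Proof.
suff [l zl] : exists l, exp_sum z n @[n --> \oo] --> l by apply: cvgP zl.
(* f stands for the real and for the imaginary part *)
have part (f : R[i] -> R) : (forall x y, f (x + y) = f x + f y) -> f 0 = 0 ->
    (forall x, `|f x|%:C <= `|x|) -> cvgn (f \o exp_sum z).
  move=> fD f0 f_le.
  have -> : f \o exp_sum z = series (fun n => f (z ^+ n / n`!%:R)).
    by apply/funext => n; rewrite /= /exp_sum /series /= (big_morph f fD f0).
  apply: normed_cvg.
  apply: series_le_cvg (is_cvg_series_exp_coeff (complex.Re `|z|)) => n.
  - exact: normr_ge0.
  - rewrite /exp_coeff /= divr_ge0 // exprn_ge0 // -lecR normc_Re_norm.
    exact: normr_ge0.
  - rewrite -lecR (le_trans (f_le _)) // normrM normfV normrX normr_nat.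
    by rewrite rmorphM fmorphV rmorphXn rmorph_nat /= normc_Re_norm.
have cRe : cvgn (@complex.Re R \o exp_sum z).
  apply: part => // [[? ?] [? ?]|x] //; exact: normc_ge_Re.
have cIm : cvgn (@complex.Im R \o exp_sum z).
  apply: part => // [[? ?] [? ?]|[x y]] //.
  rewrite normc_def lecR /= -sqrtr_sqr ler_wsqrtr // lerDr sqr_ge0 //.
by eexists; apply: cvg_complex; [exact: cRe|exact: cIm].
Qed.

(** The order of the complex numbers is partial: the case B < |l| is the only
alternative because both sides are real. *)
Lemma norm_lim_le u l (B : R[i]) : B \is Num.real ->
  u n @[n --> \oo] --> l -> (\forall n \near \oo, `|u n| <= B) -> `|l| <= B.
Proof.
move=> Br ul uB; rewrite real_leNgt ?normr_real //; apply/negP => Bl.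
have /= uB' := cvgr_norm_gt _ ul _ Bl.
near \oo => n; suff : B < B by rewrite ltxx.
apply: (@lt_le_trans _ _ `|u n|); near: n; [exact: uB'|exact: uB].
Unshelve. all: by end_near. Qed.

(** The terms of index i >= m are at most |z|^m / i!, and the sum of all
1 / i! is e.  The constant does not depend on m, which lets one bound serve all
the truncation orders of the error estimate. *)
Lemma cexp_tail m z : `|z| <= 1 ->
  `|exp_sum z m - cexp z| <= (expR 1)%:C * `|z| ^+ m.
Proof.
move=> z1; rewrite distrC.
have /norm_lim_le :
    exp_sum z n - exp_sum z m @[n --> \oo] --> cexp z - exp_sum z m.
  by apply: cvgB; [exact: cvg_exp_sum|exact: cvg_cst].
apply; first by rewrite realM ?realX ?normr_real // complex_real.
near=> n.
have mn : (m <= n)%N by near: n; exact: nbhs_infty_ge.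
rewrite /exp_sum sub_series_geq // (le_trans (ler_norm_sum _ _ _)) //.
apply: (@le_trans _ _ ((\sum_(m <= i < n) exp_coeff 1 i)%:C * `|z| ^+ m)).
  rewrite rmorph_sum mulr_suml /= big_nat [leRHS]big_nat.
  apply: ler_sum => i /andP[mi _].
  rewrite normrM normfV normrX normr_nat /exp_coeff /= expr1n mul1r.
  rewrite fmorphV rmorph_nat /= mulrC ler_wpM2l ?invr_ge0 //.
  by rewrite ler_wiXn2l.
rewrite ler_wpM2r ?exprn_ge0 // lecR.
apply: le_trans (nondecreasing_cvgn_le _ (is_cvg_series_exp_coeff (1 : R)) n).
  rewrite /series /= [leRHS](big_cat_nat (n := m)) //= lerDr sumr_ge0 // => i _.
  by rewrite exp_coeff_ge0.
by apply: nondecreasing_series => i _ _; rewrite exp_coeff_ge0.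
Unshelve. all: by end_near. Qed.

End ComplexExponential.
Arguments exp_sum {R} z n.

(** * The Pade approximant *)

Section Pade.
Variables (R : realType) (p : nat).
Implicit Types (z : R[i]) (xi : R).

Local Notation c := ((-1) ^+ p.+1 / 2 : R[i]).

Definition g_coef z (j : nat) : R[i] :=
  ((radau R p.+1)^`(j).[-1])%:C * (2 ^+ j * z ^+ (p.+1 - j)).

(** The term z^(p+1) of g is the term j = 0 of the sum, because the Radau
polynomial has value 2 (-1)^(p+1) at -1. *)
Lemma g_polyE z : (g_poly R p).[z] = c * \sum_(0 <= j < p.+2) g_coef z j.
Proof.
rewrite /g_poly hornerD hornerXn hornerZ horner_sum [in RHS]big_ltn //.
rewrite mulrDr /g_coef subn0 expr0 mul1r; congr (_ + _).
  rewrite -[(radau R p.+1)^`(0)]/(radau R p.+1) radau_left.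
  rewrite rmorphM rmorphXn rmorphN1 rmorph_nat /= mulrA.
  have -> : (-1) ^+ p.+1 / 2 * (2 * (-1) ^+ p.+1) = 1 :> R[i].
    by rewrite mulrA divfK // -expr2 sqrr_sign.
  by rewrite mul1r.
congr (_ * _); apply: eq_bigr => j _.
by rewrite hornerZ hornerXn mulrCA mulrA.
Qed.

(** The main identity with n terms of the series, free of any limit. *)
Lemma f_poly_radau_int_sum z xi n : -1 <= xi ->
  (f_poly p xi).[z] +
    c * z ^+ p.+1 * \sum_(0 <= k < n) (z / 2) ^+ k * (radau_int p.+1 k xi)%:C
  = c * \sum_(0 <= j < p.+2) g_coef z j * exp_sum (z / 2 * (xi + 1)%:C) (j + n).
Proof.
move=> xi1; set t := (xi + 1)%:C; pose r j := ((radau R p.+1)^`(j).[-1])%:C.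
have derivE k : ((radau R p.+1)^`(k).[xi])%:C = \sum_(0 <= j < p.+2)
    r j * (if (k <= j)%N then t ^+ (j - k) / (j - k)`!%:R else 0).
  rewrite (@horner_derivn_taylor _ p.+1 _ (-1)) ?size_radau // opprK.
  rewrite rmorph_sum big_mkord; apply: eq_bigr => j _.
  rewrite rmorphM /=; congr (_ * _); case: ifP => // _.
  by rewrite rmorphM fmorphV rmorphXn rmorph_nat.
have intE k : (radau_int p.+1 k xi)%:C = \sum_(0 <= j < p.+2)
    r j * (t ^+ (j + k) / (j + k)`!%:R).
  rewrite radau_int_taylor // rmorph_sum big_mkord; apply: eq_bigr => j _.
  by rewrite !rmorphM fmorphV rmorphXn rmorph_nat.
transitivity (c * \sum_(0 <= j < p.+2) r j *
    (\sum_(1 <= k < p.+2) 2 ^+ k * z ^+ (p.+1 - k) *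
      (if (k <= j)%N then t ^+ (j - k) / (j - k)`!%:R else 0)
    + z ^+ p.+1 *
      \sum_(0 <= k < n) (z / 2) ^+ k * (t ^+ (j + k) / (j + k)`!%:R))).
  under [in RHS]eq_bigr do rewrite mulrDr.
  rewrite big_split mulrDr /=; congr (_ + _).
    rewrite /f_poly hornerZ horner_sum; congr (_ * _).
    under [in RHS]eq_bigr do rewrite mulr_sumr.
    rewrite exchange_big /=; apply: eq_bigr => k _.
    rewrite hornerZ hornerXn derivE -mulrA mulr_suml mulr_sumr.
    apply: eq_bigr => j _.
    rewrite -!mulrA mulrCA; congr (_ * (_ * _)); exact: mulrC.
  under [in RHS]eq_bigr do rewrite mulrCA mulr_sumr.
  rewrite -mulr_sumr -mulrA exchange_big /=; congr (_ * (_ * _)).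
  apply: eq_bigr => k _; rewrite intE mulr_sumr.
  by apply: eq_bigr => j _; rewrite mulrCA.
congr (_ * _); apply: eq_big_nat => j /andP[_ jp].
by rewrite exp_sum_split //; exact: mulrA.
Qed.

Lemma cvg_exp_sum_comb z w :
  (\sum_(0 <= j < p.+2) g_coef z j * exp_sum w (j + n.+1)) @[n --> \oo]
    --> (\sum_(0 <= j < p.+2) g_coef z j) * cexp w.
Proof.
rewrite mulr_suml; apply: cvg_big => [|j _]; first exact: add_continuous.
apply: cvgM; first exact: cvg_cst.
have -> : (fun n => exp_sum w (j + n.+1)) = [sequence exp_sum w (n + j.+1)]_n.
  by apply/funext => n /=; rewrite addnS -addSn addnC.
by rewrite cvg_shiftn; exact: cvg_exp_sum.
Qed.

Definition tail_sum z xi : nat -> R[i] :=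
  series (fun k => (z / 2) ^+ k.+1 * (radau_int p.+1 k.+1 xi)%:C).

Lemma f_poly_tail_sum z xi n : -1 <= xi ->
  (f_poly p xi).[z] + c * z ^+ p.+1 * ((radau R p.+1).[xi]%:C + tail_sum z xi n)
  = c * \sum_(0 <= j < p.+2)
          g_coef z j * exp_sum (z / 2 * (xi + 1)%:C) (j + n.+1).
Proof.
move=> xi1; rewrite -f_poly_radau_int_sum // big_nat_recl //=.
by rewrite expr0 mul1r.
Qed.

(** For nonzero z, the finite identity expresses the partial sums by those of
the exponential series; for z = 0 every term vanishes. *)
Lemma cvg_tail_sum z xi : -1 <= xi -> cvgn (tail_sum z xi).
Proof.
move=> xi1; have [->|z0] := eqVneq z 0.
  apply/cvg_ex; exists 0.
  have -> : tail_sum 0 xi = cst 0; last exact: cvg_cst.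
  apply/funext => n; rewrite /tail_sum /series /= big1 // => k _.
  by rewrite mul0r exprS !mul0r.
have c0 : c * z ^+ p.+1 != 0.
  by rewrite !mulf_neq0 ?signr_eq0 ?invr_eq0 ?expf_neq0.
pose T n := c * \sum_(0 <= j < p.+2)
              g_coef z j * exp_sum (z / 2 * (xi + 1)%:C) (j + n.+1).
have -> : tail_sum z xi = (fun n =>
   (c * z ^+ p.+1)^-1 * (T n - (f_poly p xi).[z]) - (radau R p.+1).[xi]%:C).
  apply/funext => n; rewrite /T -f_poly_tail_sum // addrAC subrr add0r mulKf //.
  by rewrite addrAC subrr add0r.
have Tcvg : cvgn T.
  by apply: cvgP; apply: cvgM; [exact: cvg_cst|exact: cvg_exp_sum_comb].
apply: (is_cvgB (f := fun n => (c * z ^+ p.+1)^-1 * (T n - (f_poly p xi).[z]))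
  (g := cst (radau R p.+1).[xi]%:C)); last exact: is_cvg_cst.
apply: (is_cvgM (f := cst (c * z ^+ p.+1)^-1)); first exact: is_cvg_cst.
apply: (is_cvgB (f := T) (g := cst (f_poly p xi).[z])); first exact: Tcvg.
exact: is_cvg_cst.
Qed.

Lemma f_poly_expansion z xi : -1 <= xi ->
  (f_poly p xi).[z] +
    c * z ^+ p.+1 * ((radau R p.+1).[xi]%:C + limn (tail_sum z xi))
  = (g_poly R p).[z] * cexp (z / 2 * (xi + 1)%:C).
Proof.
move=> xi1; rewrite g_polyE -[RHS]mulrA.
have lhs : (f_poly p xi).[z] +
    c * z ^+ p.+1 * ((radau R p.+1).[xi]%:C + tail_sum z xi n) @[n --> \oo] -->
  (f_poly p xi).[z] +
    c * z ^+ p.+1 * ((radau R p.+1).[xi]%:C + limn (tail_sum z xi)).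
  apply: cvgD; first exact: cvg_cst.
  apply: cvgM; first exact: cvg_cst.
  by apply: cvgD; [exact: cvg_cst|exact: cvg_tail_sum].
apply: (cvg_unique (@norm_hausdorff R[i] R[i]) lhs) => /=.
have -> := funext (fun n => f_poly_tail_sum z xi n xi1).
by apply: cvgM; [exact: cvg_cst|exact: cvg_exp_sum_comb].
Qed.

(** At xi = 1 the repeated integrals of order at most p vanish, so f is a
combination of truncated exponentials and f - g e^z the same combination of
remainders: that of order j + p + 1 comes with the factor z^(p+1-j). *)
Lemma f_poly_pade_error z : `|z| <= 1 ->
  `|(f_poly p 1).[z] - (g_poly R p).[z] * cexp z| <=
  `|c| * (\sum_(0 <= j < p.+2) `|g_coef 1 j|) * (expR 1)%:C
    * `|z| ^+ (2 * p + 2).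
Proof.
move=> z1.
have z2 : z / 2 * (1 + 1)%:C = z by rewrite rmorphD rmorph1 /= divfK.
have int0 : \sum_(0 <= k < p.+1)
    (z / 2) ^+ k * (radau_int p.+1 k (1 : R))%:C = 0.
  rewrite big_nat big1 // => -[|k] /andP[_ kp].
    by rewrite /= radau_right mulr0.
  by rewrite radau_int_right ?mulr0.
have := f_poly_radau_int_sum z 1 p.+1.
rewrite z2 int0 mulr0 addr0 => ->; last by lra.
rewrite g_polyE -[_ * cexp z]mulrA -mulrBr mulr_suml -sumrB normrM.
rewrite -[leRHS]mulrA -[leRHS]mulrA.
rewrite ler_wpM2l // mulr_suml (le_trans (ler_norm_sum _ _ _)) //.
apply: ler_sum_nat => j jp.
rewrite -mulrBr normrM.
have -> : `|g_coef z j| = `|g_coef 1 j| * `|z| ^+ (p.+1 - j).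
  by rewrite /g_coef expr1n mulr1 !normrM !normrX mulrA.
rewrite -!mulrA ler_wpM2l //.
have -> : (2 * p + 2 = (p.+1 - j) + (j + p.+1))%N by lia.
rewrite exprD mulrCA ler_wpM2l ?exprn_ge0 //; exact: cexp_tail.
Qed.

Lemma g_poly0_neq0 : (g_poly R p).[0] != 0.
Proof.
rewrite g_polyE big_nat_recr //= big_nat big1 => [|j /andP[_ jp]]; last first.
  by rewrite /g_coef expr0n subn_eq0 leqNgt jp !mulr0.
rewrite add0r /g_coef subnn expr0 mulr1.
rewrite !mulf_neq0 ?signr_eq0 ?invr_eq0 ?expf_neq0 //.
by rewrite (inj_eq (@complexI R) _ 0) derivn_radau_neq0.
Qed.

Lemma size_f_poly_right : size (f_poly p 1 : {poly R[i]}) = p.+1.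
Proof.
rewrite /f_poly size_scale ?mulf_neq0 ?signr_eq0 ?invr_eq0 //.
rewrite (sum_rev_powersE _ (fun k => _ * _)) size_poly_eq //= subSnn.
rewrite mulf_neq0 ?expf_neq0 // (inj_eq (@complexI R) _ 0).
by rewrite [_^`(1)]/(_^`()) deriv_radau_right pnatr_eq0.
Qed.

Lemma size_g_poly : size (g_poly R p) = p.+2.
Proof.
rewrite /g_poly size_polyDl size_polyXn // ltnS.
rewrite (sum_rev_powersE _ (fun k => _ * _)).
exact: leq_trans (size_scale_leq _ _) (size_poly _ _).
Qed.

Lemma f_div_g_pade :
  (fun z : R[i] => (f_poly p 1).[z] / (g_poly R p).[z] - cexp z)
    =O_ (nbhs (0 : R[i])) (fun z : R[i] => z ^+ (2 * p + 2)).
Proof.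
set e := (2 * p + 2)%N; set g0 := `|(g_poly R p).[0]|.
have g0_gt0 : 0 < g0 by rewrite normr_gt0 g_poly0_neq0.
pose B := `|c| * (\sum_(0 <= j < p.+2) `|g_coef 1 j|) * (expR 1)%:C.
have B_ge0 : 0 <= B.
  by rewrite !mulr_ge0 ?sumr_ge0 // lecR expR_ge0.
(* |g| stays above g0 / 2 near 0; adding 1 makes the constant positive *)
apply/eqO_exP; exists (B * (g0 / 2)^-1 + 1).
  by rewrite ltr_wpDl // mulr_ge0 // invr_ge0 divr_ge0 // ltW.
have g_half : g0 / 2 < `|(g_poly R p).[0]|.
  by rewrite -/g0 ltr_pdivrMr // ltr_pMr // ltr1n.
near=> z.
have gz : g0 / 2 < `|(g_poly R p).[z]|.
  near: z; apply: cvgr_norm_gt g_half.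
  exact: (@continuous_horner_numField _ (g_poly R p) 0).
have z1 : `|z| <= 1.
  near: z; apply: (cvgr_norm_le (0 : R[i])); last by rewrite normr0.
  exact: cvg_id.
have gz_gt0 : 0 < `|(g_poly R p).[z]|.
  by rewrite (le_lt_trans _ gz) // divr_ge0 // ltW.
have gz0 : (g_poly R p).[z] != 0 by rewrite -normr_gt0.
have -> : (f_poly p 1).[z] / (g_poly R p).[z] - cexp z =
    ((f_poly p 1).[z] - (g_poly R p).[z] * cexp z) / (g_poly R p).[z].
  by rewrite mulrBl [_ * cexp z]mulrC mulfK.
rewrite normrM normfV normrX mulrDl mul1r ler_wpDr ?exprn_ge0 //.
rewrite [leRHS]mulrAC ler_pM ?invr_ge0 //; first exact: f_poly_pade_error.
by rewrite lef_pV2 ?posrE ?divr_gt0 // ltW.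
Unshelve. all: by end_near. Qed.

End Pade.

Theorem corollary1 (R : realType) (p : nat) :
  [/\ forall (omega : R[i]) (h : R), 0 < h ->
        (g_poly R p).[omega * h%:C] != 0 ->
        forall xi : R, -1 <= xi <= 1 ->
        let z : R[i] := omega * h%:C in
        let partial_sums : nat -> R[i] :=
          series (fun k => (z / 2) ^+ k.+1 * (radau_int p.+1 k.+1 xi)%:C) in
        cvgn partial_sums /\
        (f_poly p xi).[z] / (g_poly R p).[z] =
          cexp (z / 2 * (xi + 1)%:C)
          - (-1) ^+ p.+1 * z ^+ p.+1 / (2 * (g_poly R p).[z])
            * ((radau R p.+1).[xi]%:C + limn partial_sums),
      (fun z : R[i] => (f_poly p 1).[z] / (g_poly R p).[z] - cexp z)
        =O_ (nbhs (0 : R[i])) (fun z : R[i] => z ^+ (2 * p + 2)) &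
      is_pade p p.+1 (@cexp R) (f_poly p 1) (g_poly R p)].
Proof.
split.
- move=> omega h _ g0 xi /andP[xi1 _] z S; split; first exact: cvg_tail_sum.
  have := f_poly_expansion R p z xi xi1; rewrite -/S -/z.
  move=> /(canRL (addrK _)) ->; rewrite mulrBl mulrAC mulfV // mul1r.
  congr (_ - _).
  rewrite mulrAC; congr (_ * _).
  by rewrite invfM mulrA; congr (_ / _); rewrite mulrAC.
- exact: f_div_g_pade.
- split; [exact: size_f_poly_right|exact: size_g_poly|exact: g_poly0_neq0|].
  have -> : (p + p.+1).+1 = (2 * p + 2)%N by lia.
  exact: f_div_g_pade.
Qed.
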